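(* There is a function $F(d)$ such that the following holds. Let $C\subset\mathbb{R}^d$ be a convex body and $\mu$ a non-$C$-degenerate measure on $\mathbb{R}^d$ such that $\mu(C)>0$ and $\mu(\mathbb{R}^d)=\infty$. Then $\Theta_H(\mu,C)\le F(d)$.
   Context: A convex body is a convex compact set with nonempty interior; a homothet of $C$ is $\lambda C+x$ with $\lambda>0$, $x\in\mathbb{R}^d$. Measures are Borel measures on $\mathbb{R}^d$ finite on compact sets; $\mu$ is non-$C$-degenerate if it vanishes on the boundary of every homothet of $C$. Let $B^d$ be the open unit Euclidean ball centered at the origin. For a family $\mathcal{A}$ of sets of finite measure and a set $D$ of finite positive measure, $d_{\mathrm{inn}}(\mu,\mathcal{A}|D)=\frac{1}{\mu(D)}\sum_{A\in\mathcal{A},A\subset D}\mu(A)$, and $d_{\mathrm{low}}(\mu,\mathcal{A})=\liminf_{r\to\infty}d_{\mathrm{inn}}(\mu,\mathcal{A}|rB^d)$. The homothety covering density with respect to $\mu$ is $\Theta_H(\mu,C)=\inf\{d_{\mathrm{low}}(\mu,\mathcal{C})\}$, where the infimum is over all coverings $\mathcal{C}$ of $\mathbb{R}^d$ (families whose union is $\mathbb{R}^d$) by homothets of $C$ each of $\mu$-measure exactly $\mu(C)$. *)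

(* Defs.v *)
From HB Require Import structures.
From mathcomp Require Import all_boot all_order all_algebra.
From mathcomp Require Import all_classical all_reals all_analysis.
Set Implicit Arguments. Unset Strict Implicit. Unset Printing Implicit Defensive.
Import Order.TTheory GRing.Theory Num.Theory.
Import numFieldNormedType.Exports.
Local Open Scope classical_set_scope.
Local Open Scope ring_scope.

Section Defs.
Variables (R : realType) (d : nat).
Local Notation V := 'rV[R]_d.

Definition convex_set (C : set V) : Prop :=
  forall a b : V, C a -> C b -> forall t : R, 0 <= t -> t <= 1 ->
    C ((1 - t) *: a + t *: b).

Definition convex_body (C : set V) : Prop :=
  convex_set C /\ compact C /\ (interior C !=set0).

Definition homothet (C : set V) (lam : R) (x : V) : set V :=
  [set lam *: c + x | c in C].

Definition is_homothet (C A : set V) : Prop :=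
  exists lam : R, exists x : V, 0 < lam /\ A = homothet C lam x.

Definition borel_set (A : set V) : Prop := <<s [set B : set V | open B] >> A.

(* Borel measure on R^d (values on non-Borel sets are irrelevant) *)
Definition borel_measure (mu : set V -> \bar R) : Prop :=
  mu set0 = 0%E /\
  (forall A, borel_set A -> (0 <= mu A)%E) /\
  (forall F : nat -> set V, (forall n, borel_set (F n)) -> trivIset setT F ->
     mu (\bigcup_n F n) = (\sum_(n <oo) mu (F n))%E).

Definition finite_on_compacts (mu : set V -> \bar R) : Prop :=
  forall K : set V, compact K -> (mu K < +oo)%E.

Definition boundary (A : set V) : set V := closure A `\` interior A.

Definition non_degenerate (mu : set V -> \bar R) (C : set V) : Prop :=
  forall lam : R, forall x : V, 0 < lam -> mu (boundary (homothet C lam x)) = 0%E.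

Definition eball (r : R) : set V := [set v : V | \sum_(i < d) (v ord0 i) ^+ 2 < r ^+ 2].

Definition d_inn (mu : set V -> \bar R) (A : set (set V)) (D : set V) : \bar R :=
  ((\esum_(X in [set X | A X /\ X `<=` D]) mu X) * ((fine (mu D))^-1)%:E)%E.

Definition d_low (mu : set V -> \bar R) (A : set (set V)) : \bar R :=
  ereal_sup [set ereal_inf [set d_inn mu A (eball r) | r in [set r : R | r0 <= r]]
            | r0 in [set: R]].

Definition hcovering (mu : set V -> \bar R) (C : set V) (A : set (set V)) : Prop :=
  (forall X, A X -> is_homothet C X /\ mu X = mu C) /\
  \bigcup_(X in A) X = [set: V].

Definition Theta_H (mu : set V -> \bar R) (C : set V) : \bar R :=
  ereal_inf [set d_low mu A | A in hcovering mu C].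

End Defs.

(* Main.v *)
Require Import Defs.
From HB Require Import structures.
From mathcomp Require Import all_boot all_order all_algebra.
From mathcomp Require Import all_classical all_reals all_analysis.
From mathcomp Require Import perm measurable_realfun ring lra.
Set Implicit Arguments. Unset Strict Implicit. Unset Printing Implicit Defensive.
Import Order.TTheory GRing.Theory Num.Theory.
Import numFieldNormedType.Exports.
Local Open Scope classical_set_scope.
Local Open Scope ring_scope.

(** In coordinates given by a nearly largest simplex inscribed in [C], the body lies
    between two sup-norm balls whose ratio [m] depends only on the dimension. Let
    [H p] be the largest homothet of [C] centred at [p] of measure at most [mu C];
    since boundaries and points are null, its measure is exactly [mu C]. A greedy
    selection by radius, as in the Besicovitch-Morse theorem, covers any bounded set
    by finitely many [H p] with multiplicity at most [N = N(d)]. The radii may be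
    unbounded on R^d, so overlaps between different annuli are not controlled;
    instead the radii [r_k] grow so fast that [mu (r_k B)] exceeds the total measure
    of all homothets selected at earlier stages, while homothets centred outside
    [r_k B] are not counted in [r_k B]. This gives inner density at most [N + 1] along
    [r_k], which suffices since the lower density is a liminf. *)

(** * Colouring by a grid *)

Section RowVectorNorm.
Context {R : realType} {d : nat}.
Implicit Types v w : 'rV[R]_d.

Lemma ler_entry_norm v i : `|v ord0 i| <= `|v|.
Proof. by rewrite [leRHS]mx_normrE; apply/bigmax_geP; right; exists (ord0, i). Qed.

Lemma norm_rV_le v r : 0 <= r -> (forall i, `|v ord0 i| <= r) -> `|v| <= r.
Proof.
move=> r0 h; rewrite [leLHS]mx_normrE; apply/bigmax_leP; split=> // -[a i] _ /=.
by rewrite ord1.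
Qed.

Lemma norm_rV_lt v r : 0 < r -> (forall i, `|v ord0 i| < r) -> `|v| < r.
Proof.
move=> r0 h; rewrite [ltLHS]mx_normrE; apply/bigmax_ltP; split=> // -[a i] _ /=.
by rewrite ord1.
Qed.

(** For [|v| <= 1] each [k * (v_i + 1)] lies in [[0, 2k]], so its integer part fits the codomain and
    [inord] leaves it unchanged. *)
Definition grid_cell (k : nat) v : {ffun 'I_d -> 'I_(2 * k).+1} :=
  [ffun i => inord (Num.truncn (k%:R * (v ord0 i + 1)))].

Lemma grid_cell_close k v w : (0 < k)%N -> `|v| <= 1 -> `|w| <= 1 ->
  grid_cell k v = grid_cell k w -> `|v - w| < k%:R^-1.
Proof.
move=> k0 v1 w1 /ffunP e.
have k0' : 0 < k%:R :> R by rewrite ltr0n.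
have bnd (u : 'rV[R]_d) i : `|u| <= 1 ->
    0 <= k%:R * (u ord0 i + 1) /\ (Num.truncn (k%:R * (u ord0 i + 1)) <= 2 * k)%N.
  move=> u1; have := le_trans (ler_entry_norm u i) u1; rewrite ler_norml => /andP[a b].
  have ge0 : 0 <= k%:R * (u ord0 i + 1) by apply: mulr_ge0; [exact: ltW|lra].
  split => //; rewrite truncn_le_nat -natr1 natrM; nra.
apply: norm_rV_lt => [|i]; first by rewrite invr_gt0.
have [v0 vk] := bnd v i v1; have [w0 wk] := bnd w i w1.
have := e i; rewrite !ffunE => /(congr1 val); rewrite /= !inordK ?ltnS// => E.
have := truncn_itv v0; have := truncn_itv w0; rewrite -E.
move=> /andP[a1 a2] /andP[b1 b2].
rewrite !mxE -[ltRHS]mul1r ltr_pdivlMr// -[X in _ * X < _](gtr0_norm k0') -normrM.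
move: a2 b2; rewrite -natr1 => a2 b2.
by rewrite ltr_norml; apply/andP; split; nra.
Qed.

Lemma card_grid_cell k : #|{ffun 'I_d -> 'I_(2 * k).+1}| = ((2 * k).+1 ^ d)%N.
Proof. by rewrite card_ffun !card_ord. Qed.

End RowVectorNorm.

Lemma size_le_color (T : Type) (K : finType) (c : T -> K) (n : nat) (s : seq T) :
  (forall k, (size [seq x <- s | c x == k] <= n)%N) -> (size s <= #|K| * n)%N.
Proof.
move=> h; have -> : size s = (\sum_(k : K) count (fun x => c x == k) s)%N.
  elim: s {h} => [|x s ih] /=; first by rewrite big1.
  rewrite big_split /= -ih (bigD1 (c x)) //= eqxx big1 ?addn0 ?add1n// => k.
  by rewrite eq_sym => /negbTE ->.
rewrite -sum_nat_const; apply: leq_sum => k _; by rewrite -size_filter.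
Qed.

Lemma pairwise_neq_size_le (T : Type) (K : finType) (c : T -> K) (s : seq T) :
  pairwise (fun x y => c x != c y) s -> (size s <= #|K|)%N.
Proof.
move=> h; rewrite -(size_map c).
have u : uniq (map c s) by rewrite uniq_pairwise pairwise_map.
by rewrite -(card_uniqP u) max_card.
Qed.

(** * Position of a convex body *)

Section InscribedSimplex.
Context {R : realType} {d : nat} (C : set 'rV[R]_d).
Hypothesis convC : Defs.convex_set C.
Implicit Types (c v : 'rV[R]_d) (Q : 'M[R]_d).

(** The rows of [Q] are the edge vectors at the vertex [c], so [|\det Q|] is the volume of the
    simplex up to the factor [d!]. Degenerate simplices are allowed. *)
Definition simplex_in c Q := C c /\ forall i, C (c + row i Q).

(** Peel off one vertex: the point is a convex combination of [c + q i], with weight [y i], and a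
    point whose remaining weights are divided by [1 - y i]. The strict bound on the sum makes
    [1 - y i] positive and survives the rescaling. *)
Lemma convex_simplex c (I : Type) (s : seq I) (q : I -> 'rV[R]_d) (y : I -> R) :
  C c -> (forall i, C (c + q i)) -> (forall i, 0 <= y i) ->
  \sum_(i <- s) y i < 1 -> C (c + \sum_(i <- s) y i *: q i).
Proof.
move=> Cc Cq; elim: s y => [|i s ih] y y0; first by rewrite !big_nil addr0.
rewrite !big_cons => y1.
have s0 : 0 <= \sum_(j <- s) y j by rewrite sumr_ge0.
have yi0 := y0 i.
have yi1 : 0 < 1 - y i by lra.
have -> : c + (y i *: q i + \sum_(j <- s) y j *: q j) =
  (1 - y i) *: (c + \sum_(j <- s) ((1 - y i)^-1 * y j) *: q j) + y i *: (c + q i).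
  have -> : \sum_(j <- s) ((1 - y i)^-1 * y j) *: q j =
      (1 - y i)^-1 *: \sum_(j <- s) y j *: q j.
    by rewrite scaler_sumr; apply: eq_bigr => j _; rewrite scalerA.
  rewrite !scalerDr scalerA divff ?gt_eqF// scale1r scalerBl scale1r.
  by rewrite [RHS]addrACA subrK; congr (_ + _); rewrite addrC.
apply: convC => //; last by lra.
apply: ih => [j|]; first by rewrite mulr_ge0// invr_ge0 ltW.
by rewrite -mulr_sumr mulrC ltr_pdivrMr// mul1r; lra.
Qed.

(** Entries of [Q] are coordinate differences of two points of [C], so the Leibniz expansion is
    bounded term by term. *)
Lemma det_bounded : bounded_set C -> has_ubound [set `|\det p.2| | p in [set p | simplex_in p.1 p.2]].
Proof.
move=> [M [_ hM]]; pose b := M + 1.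
have hb v : C v -> `|v| <= b by apply: hM; rewrite ltrDl.
exists (\sum_(s : 'S_d) \prod_(i < d) (b + b)) => _ [[c Q] [/= Cc CQ] <-].
have entry i j : `|Q i j| <= b + b.
  have -> : Q i j = (row i Q) ord0 j by rewrite mxE.
  apply: le_trans (ler_entry_norm _ _) _.
  have -> : row i Q = (c + row i Q) - c by rewrite addrC addKr.
  by apply: le_trans (ler_normB _ _) _; rewrite lerD// hb.
rewrite /determinant; apply: le_trans (ler_norm_sum _ _ _) _.
apply: ler_sum => s _; rewrite normrM normrX normrN1 expr1n mul1r normr_prod.
by apply: ler_prod => i _; rewrite normr_ge0 entry.
Qed.

Lemma interior_simplex : interior C !=set0 -> exists c Q, simplex_in c Q /\ \det Q != 0.
Proof.
move=> [c /nbhs_ballP [e /= e0 he]]; exists c, ((e / 2)%:M).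
have e2 : 0 < e / 2 by rewrite divr_gt0.
split; last by rewrite det_scalar expf_neq0// gt_eqF.
split=> [|i]; first by apply: he; exact: ballxx.
apply: he; rewrite -ball_normE /= opprD addrA subrr add0r normrN.
apply: le_lt_trans (_ : e / 2 < e); last by lra.
apply: norm_rV_le => [|j]; first exact: ltW.
rewrite !mxE; case: (_ == _); last by rewrite normr0 ltW.
by rewrite mulr1n gtr0_norm.
Qed.

(** Cramer's rule: the coordinate of [v] along an edge is the factor by which the volume changes
    when [v] replaces that edge. *)
Lemma coord_det c Q v i : \det Q != 0 ->
  (v *m invmx Q) ord0 i = \det (\matrix_(k, j) if k == i then v ord0 j else Q k j) / \det Q.
Proof.
move=> Q0; rewrite /invmx unitmxE unitfE Q0 -scalemxAr mxE mulrC; congr (_ * _).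
rewrite mxE (expand_det_row _ i); apply: eq_bigr => j _.
rewrite !mxE eqxx; congr (_ * _); rewrite /cofactor; congr (_ * \det _).
by apply/matrixP => a b; rewrite !mxE eq_sym (negbTE (neq_lift _ _)).
Qed.

(* Take an inscribed simplex of more than half the largest volume: then the
   coordinates of points of [C] are at most 2 in absolute value, and [x0] is the
   barycentre of the simplex. *)
Lemma convex_body_position : bounded_set C -> interior C !=set0 ->
  exists (x0 : 'rV[R]_d) (B : 'M[R]_d), B \in unitmx /\
    (forall v, `|v *m B| <= 1 -> C (x0 + v)) /\
    (forall v, C (x0 + v) -> `|v *m B| <= (3 * d.+1 ^ 2)%:R).
Proof.
move=> bC iC; have ub := det_bounded bC.
set D := [set _ | _ in _] in ub.
have [c1 [Q1 [S1 Q10]]] := interior_simplex iC.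
have D1 : D `|\det Q1| by exists (c1, Q1).
have supD : has_sup D by split => //; exists `|\det Q1|.
have sup0 : 0 < sup D.
  by apply: lt_le_trans (sup_upper_bound supD D1); rewrite normr_gt0.
have [_ [[c Q] [/= Cc CQ] <-] hQ] := sup_adherent (divr_gt0 sup0 (ltr0n R 2)) supD.
have Q0 : \det Q != 0 by rewrite -normr_gt0; lra.
have uQ : Q \in unitmx by rewrite unitmxE unitfE.
have coord2 v : C v -> forall i, `|((v - c) *m invmx Q) ord0 i| <= 2.
  move=> Cv i; rewrite coord_det// normrM normfV ler_pdivrMr ?normr_gt0//.
  suff : `|\det (\matrix_(k, j) (if k == i then (v - c) ord0 j else Q k j))| <= sup D.
    by lra.
  (* Replacing the [i]-th edge by [v - c] turns that vertex into [v], which gives another inscribed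
     simplex. *)
  apply: sup_upper_bound => //; exists (c, \matrix_(k, j) (if k == i then (v - c) ord0 j else Q k j)) => //.
  split => //= k; case: (eqVneq k i) => [->|ki].
    suff -> : row i (\matrix_(k0, j) (if k0 == i then (v - c) ord0 j else Q k0 j)) = v - c.
      by rewrite addrC subrK.
    by apply/rowP => j; rewrite !mxE eqxx.
  suff -> : row k (\matrix_(k0, j) (if k0 == i then (v - c) ord0 j else Q k0 j)) = row k Q by [].
  by apply/rowP => j; rewrite !mxE (negbTE ki).
pose n : R := d.+1%:R; have n0 : 0 < n by rewrite ltr0n.
have n1 : 1 <= n by rewrite ler1n.
pose g : 'rV[R]_d := const_mx n^-1.
have gn i : g ord0 i = n^-1 by rewrite mxE.
(* Changing the barycentre's coordinates [1/n] by at most [1/n^2] keeps them nonnegative with sum at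
   most [(n - 1)(1/n + 1/n^2) = 1 - 1/n^2]; the factor [n^2] turns this tolerance into the unit
   ball. In the other direction the coordinates are at most [2 + 1/n <= 3], whence [3 * n^2]. *)
exists (c + g *m Q), (n ^+ 2 *: invmx Q); split; last split.
- rewrite unitmxE detZ unitrM unitfE expf_neq0 ?expf_neq0 ?gt_eqF//=.
  by rewrite -unitmxE unitmx_inv.
- move=> v; rewrite -scalemxAr normrZ gtr0_norm ?exprn_gt0// => hv.
  set y := v *m invmx Q in hv.
  have vE : v = y *m Q by rewrite /y mulmxKV.
  have hy i : `|y ord0 i| <= (n ^+ 2)^-1.
    apply: le_trans (ler_entry_norm _ _) _.
    by rewrite -[leRHS]mulr1 ler_pdivlMl ?exprn_gt0.
  have -> : c + g *m Q + v = c + \sum_i (g + y) ord0 i *: row i Q.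
    by rewrite vE -addrA -mulmxDl mulmx_sum_row.
  have nn : (n ^+ 2)^-1 <= n^-1.
    by rewrite lef_pV2 ?posrE ?exprn_gt0// expr2 ler_peMl// ltW.
  apply: convex_simplex => // [i|].
    rewrite mxE gn; have := hy i; rewrite ler_norml => /andP[h _].
    by rewrite -(subrr (n ^+ 2)^-1) lerD.
  apply: le_lt_trans (_ : \sum_(i < d) (n^-1 + (n ^+ 2)^-1) < 1).
    apply: ler_sum => i _; rewrite mxE gn.
    by rewrite lerD2l (le_trans (ler_norm _)).
  rewrite sumr_const card_ord -mulr_natr.
  have -> : d%:R = n - 1 :> R by rewrite /n -natr1 addrK.
  have -> : (n^-1 + (n ^+ 2)^-1) * (n - 1) = 1 - (n ^+ 2)^-1 by field; rewrite gt_eqF.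
  by rewrite ltrBlDr ltrDl invr_gt0 exprn_gt0.
- move=> v Cv; rewrite -scalemxAr normrZ gtr0_norm ?exprn_gt0//.
  rewrite natrM natrX mulrC ler_pM2r ?exprn_gt0//.
  apply: norm_rV_le => // i.
  have -> : v *m invmx Q = (c + g *m Q + v - c) *m invmx Q - g.
    rewrite -!addrA addrC -!addrA [- c + _]addNr addr0.
    by rewrite mulmxDl mulmxK// addrAC subrr add0r.
  rewrite mxE [(- g) _ _]mxE gn.
  apply: le_trans (ler_normB _ _) _.
  have := coord2 _ Cv i; set t := `|_|; rewrite gtr0_norm ?invr_gt0// => t2.
  have u1 : n^-1 <= 1 by rewrite invf_le1.
  by rewrite (_ : 3%:R = 2 + 1 :> R) ?lerD// natr1.
Qed.

End InscribedSimplex.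

(** * Greedy selection and multiplicity *)

Section CenteredHomothets.
Context {R : realType} {d : nat} (C : set 'rV[R]_d).
Variables (x0 : 'rV[R]_d) (B : 'M[R]_d) (m : nat).
Hypothesis convC : Defs.convex_set C.
Hypothesis unitB : B \in unitmx.
Hypothesis ball_in : forall v, `|v *m B| <= 1 -> C (x0 + v).
Hypothesis in_ball : forall v, C (x0 + v) -> `|v *m B| <= m%:R.
Implicit Types (p q v w x : 'rV[R]_d) (lam : R).

(** The translation is chosen so that the interior reference point [x0] of [C] is sent to [p]. *)
Definition homothet_at p lam := homothet C lam (p - lam *: x0).

Lemma homothet_atP p lam x : 0 < lam -> homothet_at p lam x <-> C (x0 + lam^-1 *: (x - p)).
Proof.
move=> l0; have ln : lam != 0 by rewrite gt_eqF.
split=> [[c Cc <-]|h].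
  by rewrite addrA addrAC addrK -scalerBr scalerA mulVf// scale1r addrC subrK.
exists (x0 + lam^-1 *: (x - p)) => //.
rewrite scalerDr scalerA divff// scale1r; apply/rowP => i; rewrite !mxE; ring.
Qed.

Lemma homothet_at_ball_in p lam x : 0 < lam -> `|(x - p) *m B| <= lam -> homothet_at p lam x.
Proof.
move=> l0 h; apply/homothet_atP => //; apply: ball_in.
by rewrite -scalemxAl normrZ gtr0_norm ?invr_gt0// mulrC ler_pdivrMr// mul1r.
Qed.

Lemma homothet_at_in_ball p lam x : 0 < lam -> homothet_at p lam x -> `|(x - p) *m B| <= m%:R * lam.
Proof.
move=> l0 /homothet_atP => /(_ l0) /in_ball.
by rewrite -scalemxAl normrZ gtr0_norm ?invr_gt0// mulrC ler_pdivrMr.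
Qed.

Lemma homothet_at_center p lam : 0 < lam -> homothet_at p lam p.
Proof. by move=> l0; apply: homothet_at_ball_in => //; rewrite subrr mul0mx normr0 ltW. Qed.

Lemma homothet_at_convex p lam : 0 < lam -> Defs.convex_set (homothet_at p lam).
Proof.
move=> l0 x y /homothet_atP => /(_ l0) hx /homothet_atP => /(_ l0) hy t t0 t1.
apply/homothet_atP => //; have := convC hx hy t0 t1; congr C.
have -> : (1 - t) *: x + t *: y - p = (1 - t) *: (x - p) + t *: (y - p).
  by rewrite !scalerBr addrACA -opprD -scalerDl subrK scale1r.
rewrite !scalerDr addrACA -scalerDl subrK scale1r !scalerA.
by rewrite [_^-1 * (1 - t)]mulrC [_^-1 * t]mulrC.
Qed.

(** With [t = (mu - lam) / mu], the preimage in [C] of a point under the larger homothety is [1 - t]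
    times its preimage under the smaller one plus [t] times [x0 + (p - q) / (mu - lam)], which is in
    [C] by [ball_in]. For equal radii the centres must coincide. *)
Lemma homothet_at_mono p q lam mu : 0 < lam -> lam <= mu -> `|(p - q) *m B| <= mu - lam ->
  homothet_at p lam `<=` homothet_at q mu.
Proof.
move=> l0; rewrite le_eqVlt => /orP[/eqP <-|lm].
  rewrite subrr normr_le0 => /eqP h x.
  suff -> : p = q by [].
  by apply/eqP; rewrite -subr_eq0 -[p - q](mulmxK unitB) h mul0mx.
move=> h x /homothet_atP => /(_ l0) hx; have m0 := lt_trans l0 lm.
have ml0 : 0 < mu - lam by rewrite subr_gt0.
apply/homothet_atP => //.
have hb : C (x0 + (mu - lam)^-1 *: (p - q)).
  by apply: ball_in; rewrite -scalemxAl normrZ gtr0_norm ?invr_gt0// mulrC ler_pdivrMr// mul1r.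
have t0 : 0 <= (mu - lam) / mu by rewrite divr_ge0 ?ltW.
have t1 : (mu - lam) / mu <= 1 by rewrite ler_pdivrMr// mul1r; lra.
have := convC hx hb t0 t1; congr C.
rewrite !scalerDr addrACA -scalerDl subrK scale1r !scalerA; congr (_ + _).
have -> : (1 - (mu - lam) / mu) / lam = mu^-1 by field; rewrite !gt_eqF.
have -> : (mu - lam) / mu / (mu - lam) = mu^-1 by field; rewrite !gt_eqF.
by apply/rowP => i; rewrite !mxE; ring.
Qed.

Lemma homothet_at_le p lam mu : 0 < lam -> lam <= mu -> homothet_at p lam `<=` homothet_at p mu.
Proof. by move=> l0 lm; apply: homothet_at_mono => //; rewrite subrr mul0mx normr0 subr_ge0. Qed.

Lemma homothet_at_is_homothet p lam : 0 < lam -> is_homothet C (homothet_at p lam).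
Proof. by move=> l0; exists lam, (p - lam *: x0). Qed.

Variable lam : 'rV[R]_d -> R.

(* Read: [p] is chosen before [q]. *)
Definition selected p q := (lam q <= 2 * lam p) && `[< ~ homothet_at p (lam p) q >].

Lemma selected_sep p q : 0 < lam p -> selected p q -> lam p < `|(q - p) *m B|.
Proof.
by move=> p0 /andP[_ /asboolP h]; rewrite ltNge; apply/negP => /(homothet_at_ball_in p0).
Qed.

(** Induction on the maximal length of an [a]-separated sequence in [T]. Once [p] is chosen, the
    points outside its homothet are farther than [lam p >= a] from [p], so any separated sequence
    among them can be extended by [p]. *)
Lemma greedy (a b : R) (T : set 'rV[R]_d) (n : nat) : 0 < a ->
  (forall p, T p -> a <= lam p <= b) ->
  (forall s, (forall p, p \in s -> T p) ->
     pairwise (fun p q => a < `|(q - p) *m B|) s -> (size s <= n)%N) ->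
  exists s, [/\ forall p, p \in s -> T p, pairwise selected s &
     forall x, T x -> exists2 p, p \in s & homothet_at p (lam p) x].
Proof.
move=> a0; elim: n T => [|n ih] T bT sT.
  exists [::]; split => // x Tx.
  have : (size [:: x] <= 0)%N by apply: sT => // p; rewrite inE => /eqP ->.
  by [].
have [[p0 Tp0]|T0] := pselect (T !=set0); last first.
  by exists [::]; split => // x Tx; case: T0; exists x.
have supT : has_sup (lam @` T).
  split; first by exists (lam p0); exists p0.
  by exists b => _ [p Tp <-]; case/andP: (bT p Tp).
have s0 : 0 < sup (lam @` T).
  apply: lt_le_trans a0 _; have /andP[h _] := bT p0 Tp0.
  by apply: le_trans h _; apply: sup_upper_bound => //; exists p0.
(* The supremum of the radii need not be attained, so [p] only has more than half of it; this is the
   factor 2 in [selected]. *)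
have [_ [p Tp <-] hp] := sup_adherent (divr_gt0 s0 (ltr0n R 2)) supT.
have le2 q : T q -> lam q <= 2 * lam p.
  move=> Tq; have : lam q <= sup (lam @` T) by apply: sup_upper_bound => //; exists q.
  by lra.
have /andP[alp _] := bT p Tp.
have p1 : 0 < lam p by apply: lt_le_trans a0 _.
have [] := ih (T `\` homothet_at p (lam p)) => [q [/bT]//|s hs ps|s [hs ps cs]].
  suff : (size (p :: s) <= n.+1)%N by [].
  apply: sT => [q|]; first by rewrite inE => /orP[/eqP ->//|/hs[]].
  rewrite /= ps andbT; apply/allP => q /hs[Tq nq].
  apply: le_lt_trans alp _; rewrite ltNge; apply/negP => /(homothet_at_ball_in p1); exact: nq.
exists (p :: s); split=> [q||x Tx].
- by rewrite inE => /orP[/eqP ->//|/hs[]].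
- rewrite /= ps andbT; apply/allP => q /hs[Tq nq].
  by rewrite /selected le2//; apply/asboolP.
- have [hx|hx] := pselect (homothet_at p (lam p) x); first by exists p => //; rewrite mem_head.
  have [//|q qs hq] := cs x; by exists q => //; rewrite inE qs orbT.
Qed.

(** After scaling by [1/L], two points in one cell of mesh [1/k <= a/L] would be closer than [a]
    before scaling. *)
Lemma separated_size (a L : R) : 0 < a -> 0 < L -> exists n, forall s,
  (forall p, p \in s -> `|p *m B| <= L) ->
  pairwise (fun p q => a < `|(q - p) *m B|) s -> (size s <= n)%N.
Proof.
move=> a0 L0; pose k := (Num.truncn (L / a)).+1.
have k0 : 0 < k%:R :> R by rewrite ltr0n.
have hk : k%:R^-1 <= a / L.
  rewrite invf_ple ?posrE ?divr_gt0// invf_div.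
  by have /andP[_ /ltW] := truncn_itv (ltW (divr_gt0 L0 a0)).
exists #|{ffun 'I_d -> 'I_(2 * k).+1}| => s hs ps.
apply: (pairwise_neq_size_le (c := fun p => grid_cell k (L^-1 *: (p *m B)))).
apply: (sub_in_pairwise (P := mem s)) ps; last exact/allP.
move=> p q /hs hp /hs hq; rewrite ltNge; apply: contra => /eqP e.
have nL v : `|v *m B| <= L -> `|L^-1 *: (v *m B)| <= 1.
  by move=> h; rewrite normrZ gtr0_norm ?invr_gt0// mulrC ler_pdivrMr// mul1r.
have := grid_cell_close (ltn0Sn _) (nL _ hq) (nL _ hp) (esym e).
rewrite -scalerBr -mulmxBl normrZ gtr0_norm ?invr_gt0// => h.
have := lt_le_trans h hk; rewrite mulrC ltr_pM2r ?invr_gt0//; exact: ltW.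
Qed.

(** The first factor counts direction cells as seen from a common point, the second counts position
    cells within one direction class. *)
Definition multiplicity := ((2 * m).+1 ^ d * (2 * (4 * m ^ 2)).+1 ^ d)%N.

Hypothesis m0 : (0 < m)%N.

(* If the directions from x to two selected centres agree up to 1/m, the later
   centre is the farther one, as the earlier homothet contains a cone at x. *)
Lemma direction_farther x p q : 0 < lam p -> homothet_at p (lam p) x -> selected p q ->
  grid_cell m (`|(p - x) *m B|^-1 *: ((p - x) *m B)) =
  grid_cell m (`|(q - x) *m B|^-1 *: ((q - x) *m B)) ->
  `|(p - x) *m B| < `|(q - x) *m B|.
Proof.
move=> p0 hx /andP[_ /asboolP nq] e; rewrite ltNge; apply/negP => le_qp; apply: nq.
set b := `|(q - x) *m B| in e le_qp; set a := `|(p - x) *m B| in e le_qp.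
have m0' : 0 < m%:R :> R by rewrite ltr0n.
have [b0|bn0] := eqVneq b 0.
  suff <- : x = q by [].
  move: b0 => /eqP; rewrite normr_eq0 => /eqP b0; apply/esym/eqP.
  by rewrite -subr_eq0 -[q - x](mulmxK unitB) b0 mul0mx.
have bgt : 0 < b by rewrite lt_def bn0 normr_ge0.
have agt : 0 < a by apply: lt_le_trans le_qp.
have n1 w c : c = `|w *m B| -> 0 < c -> `|c^-1 *: (w *m B)| <= 1.
  by move=> -> c0; rewrite normrZ gtr0_norm ?invr_gt0// mulVf ?gt_eqF.
have := grid_cell_close m0 (n1 _ _ (erefl b) bgt) (n1 _ _ (erefl a) agt) (esym e).
move=> h; have am : a <= m%:R * lam p.
  by rewrite /a -opprB mulNmx normrN; exact: homothet_at_in_ball.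
(* If [q] were no farther than [p], then [q = (1 - t) x + t z], where [z - p] is [a] times the
   difference of the two unit directions. Its length is at most [a/m <= lam p], so [z], and by
   convexity [q], would lie in the homothet at [p]. *)
pose t := b / a; have t0 : 0 < t by rewrite divr_gt0.
have t1 : t <= 1 by rewrite ler_pdivrMr// mul1r.
have hz : homothet_at p (lam p) (p + t^-1 *: (q - x - t *: (p - x))).
  apply: homothet_at_ball_in => //; rewrite addrC addKr.
  have -> : t^-1 *: (q - x - t *: (p - x)) = a *: (b^-1 *: (q - x) - a^-1 *: (p - x)).
    by rewrite !scalerBr !scalerA mulVf ?gt_eqF// divff ?gt_eqF// /t invf_div.
  rewrite -scalemxAl mulmxBl -!scalemxAl normrZ gtr0_norm//.
  apply: le_trans (_ : a * m%:R^-1 <= _); first by rewrite ler_pM2l// ltW.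
  by rewrite ler_pdivrMr// mulrC.
have := homothet_at_convex p0 hx hz (ltW t0) t1; congr (homothet_at p (lam p)).
rewrite scalerDr scalerA divff ?gt_eqF// scale1r scalerBl scale1r scalerBr.
apply/rowP => i; rewrite !mxE; ring.
Qed.

(** Split the centres by direction from [x]. Within a class all radii are comparable to that of the
    first centre, so the centres lie in a ball around [x] and are separated by a fixed fraction of
    its radius; a second grid bounds their number. *)
Lemma multiplicity_le (s : seq 'rV[R]_d) x :
  (forall p, p \in s -> 0 < lam p) -> pairwise selected s ->
  (size [seq p <- s | `[< homothet_at p (lam p) x >]] <= multiplicity)%N.
Proof.
move=> s0 ps; set s1 := [seq _ <- _ | _].
have s1h p : p \in s1 -> homothet_at p (lam p) x /\ 0 < lam p.
  by rewrite mem_filter => /andP[/asboolP ? /s0].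
have ps1 : pairwise selected s1 by apply: pairwise_filter.
rewrite /multiplicity -card_grid_cell.
apply: (size_le_color (c := fun p => grid_cell m (`|(p - x) *m B|^-1 *: ((p - x) *m B)))).
move=> k; set s2 := [seq _ <- _ | _].
have s2h p : p \in s2 -> [/\ homothet_at p (lam p) x, 0 < lam p &
    grid_cell m (`|(p - x) *m B|^-1 *: ((p - x) *m B)) = k].
  by rewrite mem_filter => /andP[/eqP ? /s1h[]].
have ps2 : pairwise selected s2 by apply: pairwise_filter.
have m0' : 0 < m%:R :> R by rewrite ltr0n.
(* Since [q] is farther from [x] than [p], [lam p < |q - p| <= |q - x| + |p - x| < 2 |q - x| <= 2 m
   lam q], in the norm given by [B]. *)
have cmp p q : p \in s2 -> q \in s2 -> selected p q -> lam p < 2 * m%:R * lam q.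
  move=> /s2h[hp p0 kp] /s2h[hq q0 kq] pq.
  have far := direction_farther p0 hp pq (etrans kp (esym kq)).
  have := selected_sep p0 pq.
  have -> : q - p = (q - x) - (p - x) by rewrite opprB addrA subrK.
  rewrite mulmxBl => sep; have := lt_le_trans sep (ler_normB _ _) => {}sep.
  have := homothet_at_in_ball q0 hq; rewrite -opprB mulNmx normrN.
  move: sep far; set u := `|_|; set v := `|_| => *.
  by rewrite -mulrA; lra.
case E : s2 => [//|p s3]; rewrite -E; have ps' : p \in s2 by rewrite E mem_head.
have [hp p0 kp] := s2h _ ps'.
(* Every centre of the class is within [m * lam q <= L] of [x], and two of them are more than
   [lam p / (2m) = L / (4 m^2)] apart; hence the grid parameter [4 * m ^ 2]. *)
pose L := 2 * m%:R * lam p; have L0 : 0 < L by rewrite !mulr_gt0// ltr0n.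
have from_p q : q \in s2 -> lam p <= 2 * m%:R * lam q /\ lam q <= 2 * lam p.
  move=> qs; move: ps2; rewrite E /= => /andP[/allP h _].
  move: (qs); rewrite E inE => /orP[/eqP ->|qs3].
    have := ltr0n R 2 => two; split; last by lra.
    have : 1 <= m%:R :> R by rewrite ler1n.
    by nra.
  by have pq := h _ qs3; split; [exact/ltW/cmp|case/andP: pq].
have nL q : q \in s2 -> `|L^-1 *: ((q - x) *m B)| <= 1.
  move=> qs; have [hq q0 _] := s2h _ qs; have [_ l2] := from_p _ qs.
  rewrite normrZ gtr0_norm ?invr_gt0// mulrC ler_pdivrMr// mul1r -opprB mulNmx normrN.
  apply: le_trans (homothet_at_in_ball q0 hq) _.
  by rewrite /L [2 * _]mulrC -mulrA ler_pM2l.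
rewrite -card_grid_cell.
apply: (pairwise_neq_size_le (c := fun q => grid_cell (4 * m ^ 2) (L^-1 *: ((q - x) *m B)))).
apply: (sub_in_pairwise (P := mem s2)) ps2; last exact/allP.
move=> q r qs rs qr; apply/eqP => e.
have [hq q0 _] := s2h _ qs; have [pq _] := from_p _ qs.
have k0 : (0 < 4 * m ^ 2)%N by rewrite muln_gt0 expn_gt0 m0.
have := grid_cell_close k0 (nL _ rs) (nL _ qs) (esym e).
rewrite -scalerBr -mulmxBl opprB addrA subrK normrZ gtr0_norm ?invr_gt0//.
rewrite mulrC ltr_pdivrMr// => h.
have := lt_trans (selected_sep q0 qr) h.
rewrite mulrC ltr_pdivlMr ?ltr0n// natrM natrX /L ltNge => /negP; apply.
by move: pq m0' q0; set M := m%:R; nra.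
Qed.

End CenteredHomothets.

(** * Borel measures *)

Section BorelMeasure.
Context {R : realType} {d : nat} (mu : set 'rV[R]_d -> \bar R).
Hypothesis bmu : borel_measure mu.

Let T := g_sigma_algebraType [set U : set 'rV[R]_d | open U].

(* [mu] is unconstrained outside the Borel sets, whereas a [measure] is
   nonnegative everywhere. *)
Let nu (A : set T) : \bar R := if `[< borel_set A >] then mu A else 0%E.

Let nuE (A : set T) : borel_set A -> nu A = mu A.
Proof. by move=> /asboolP bA; rewrite /nu bA. Qed.

Let nu0 : nu set0 = 0%E.
Proof. by rewrite /nu bmu.1; case: ifP. Qed.

Let nu_ge0 A : (0 <= nu A)%E.
Proof. by rewrite /nu; case: ifPn => // /asboolP /(bmu.2.1 A). Qed.

Let nu_sigma : semi_sigma_additive nu.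
Proof.
move=> F mF tF mU; rewrite (nuE mU) bmu.2.2//.
rewrite (_ : (fun n => \sum_(0 <= i < n) nu (F i))%E = (fun n => \sum_(0 <= i < n) mu (F i))%E).
  by apply: is_cvg_nneseries => n _ _; exact: (bmu.2.1 _ (mF n)).
by apply/funext => n; apply: eq_bigr => i _; rewrite (nuE (mF i)).
Qed.

HB.instance Definition _ := isMeasure.Build _ T R nu nu0 nu_ge0 nu_sigma.

Lemma borel_closed (A : set 'rV[R]_d) : closed A -> borel_set A.
Proof.
move=> cA; rewrite -[A]setCK; apply: (@measurableC _ T).
by apply: sub_sigma_algebra; exact: closed_openC.
Qed.

Lemma borel_open (A : set 'rV[R]_d) : open A -> borel_set A.
Proof. exact: sub_sigma_algebra. Qed.

Lemma borel_ge0 A : borel_set A -> (0 <= mu A)%E.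
Proof. exact: bmu.2.1. Qed.

Lemma borel_le A E : borel_set A -> borel_set E -> A `<=` E -> (mu A <= mu E)%E.
Proof. by move=> bA bE AE; rewrite -!nuE//; apply: le_measure; rewrite ?inE. Qed.

Lemma borel_leU A E F : borel_set A -> borel_set E -> borel_set F -> A `<=` E `|` F ->
  (mu A <= mu E + mu F)%E.
Proof.
move=> bA bE bF h; have bU : borel_set (E `|` F) by apply: (@measurableU _ T).
apply: le_trans (borel_le bA bU h) _; rewrite -!nuE//; exact: (@measureU2 _ T R nu _ _ bE bF).
Qed.

Lemma borel_bigcup (F : nat -> set 'rV[R]_d) : (forall n, borel_set (F n)) ->
  borel_set (\bigcup_n F n).
Proof. by move=> bF; apply: (@bigcupT_measurable _ T). Qed.

Lemma borel_bigcup_le (F : nat -> set 'rV[R]_d) c : (forall n, borel_set (F n)) ->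
  nondecreasing_seq F -> (forall n, mu (F n) <= c)%E -> (mu (\bigcup_n F n) <= c)%E.
Proof.
move=> bF ndF h; have bU := borel_bigcup bF; rewrite -nuE//.
have cF := @nondecreasing_cvg_mu _ T R nu F bF bU ndF.
rewrite -(cvg_lim _ cF)//; apply: lime_le; first by apply/cvg_ex; eexists; exact: cF.
by apply: nearW => n /=; rewrite nuE.
Qed.

Lemma borel_bigcap_ge (F : nat -> set 'rV[R]_d) c : (forall n, borel_set (F n)) ->
  nonincreasing_seq F -> (mu (F 0%N) < +oo)%E -> (forall n, c <= mu (F n))%E ->
  (c <= mu (\bigcap_n F n))%E.
Proof.
move=> bF niF F0 h.
have bI : borel_set (\bigcap_n F n) by apply: (@bigcapT_measurable _ T).
rewrite -nuE//; rewrite -nuE// in F0.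
have cF := @nonincreasing_cvg_mu _ T R nu F F0 bF bI niF.
rewrite -(cvg_lim _ cF)//; apply: lime_ge; first by apply/cvg_ex; eexists; exact: cF.
by apply: nearW => n /=; rewrite nuE.
Qed.

(** Integrate the sum of the indicators over [D]: at each point it is at most the multiplicity
    [n]. *)
Lemma borel_overlap (I : Type) (s : seq I) (H : I -> set 'rV[R]_d) (n : nat) D :
  (forall i, borel_set (H i)) -> borel_set D ->
  (forall x, (size [seq i <- s | `[< H i x >]] <= n)%N) ->
  (\sum_(i <- s | `[< H i `<=` D >]) mu (H i) <= n%:R%:E * mu D)%E.
Proof.
move=> bH bD hn; rewrite -big_filter -nuE//; set t := [seq _ <- _ | _].
have ht : all (fun i => `[< H i `<=` D >]) t by apply: filter_all.
have -> : (\sum_(i <- t) mu (H i) = \sum_(i <- t) \int[nu]_(x in D) (\1_(H i) x)%:E)%E.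
  elim: t ht => [|i t ih] /=; first by rewrite !big_nil.
  move=> /andP[/asboolP hi /ih e]; rewrite !big_cons e; congr (_ + _)%E.
  by rewrite (@integral_indic _ T R nu D bD _ (bH i)) setIidl//; exact: (esym (nuE (bH i))).
rewrite -(@ge0_integral_sum _ T R nu D bD)//; last first.
  by move=> i; apply/measurable_EFinP; apply: measurable_indic; exact: bH.
rewrite -(@integral_cst _ T R nu D bD); apply: (@ge0_le_integral _ T R nu D bD) => //.
- by move=> x _; apply: sume_ge0 => i _; rewrite lee_fin.
- by apply: emeasurable_sum => i; apply/measurable_EFinP; apply: measurable_indic; exact: bH.
move=> x Dx; rewrite sumEFin lee_fin.
apply: le_trans (_ : (size [seq i <- t | `[< H i x >]])%:R <= _).
  elim: t {ht} => [|i t ih] /=; first by rewrite big_nil.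
  rewrite big_cons indicE; case: asboolP => hx /=.
    by rewrite mem_set//= -[leRHS]natr1 addrC lerD.
  by rewrite memNset//= add0r.
rewrite ler_nat; apply: leq_trans (hn x).
rewrite /t -filter_predI !size_filter; apply: sub_count => i /= /andP[]//.
Qed.

End BorelMeasure.

(** * Homothets of prescribed measure *)

Lemma closed_point (R : realType) (d : nat) (p : 'rV[R]_d) : closed [set p].
Proof. exact: (accessible_closed_set1 (hausdorff_accessible (@norm_hausdorff _ _))). Qed.

Lemma mulmx_norm_le (R : realType) (d : nat) (B : 'M[R]_d) :
  exists2 K, 0 < K & forall v : 'rV[R]_d, `|v *m B| <= K * `|v|.
Proof.
pose K := 1 + \sum_i \sum_j `|B i j|.
have K0 : 0 <= \sum_i \sum_j `|B i j| by rewrite !sumr_ge0// => i _; rewrite sumr_ge0.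
exists K; first by rewrite /K ltr_wpDr.
move=> v; apply: norm_rV_le => [|j]; first by rewrite mulr_ge0// /K addr_ge0.
rewrite mxE; apply: le_trans (ler_norm_sum _ _ _) _.
rewrite /K mulrDl mul1r ler_wpDl// mulr_suml; apply: ler_sum => i _.
rewrite normrM mulrC ler_pM//; last exact: ler_entry_norm.
by rewrite (bigD1 j)//= lerDl sumr_ge0.
Qed.

Lemma compact_norm_le (R : realType) (d : nat) (r : R) : compact [set v : 'rV[R]_d | `|v| <= r].
Proof.
apply: bounded_closed_compact.
  by exists r; split; [exact: num_real|move=> M /ltW rM v /= vr; exact: le_trans vr rM].
rewrite (_ : [set v : 'rV[R]_d | `|v| <= r] = (fun v : 'rV[R]_d => `|v|) @^-1` [set x | x <= r]) //.
by apply: closed_comp => [v _|]; [exact: norm_continuous|exact: closed_le].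
Qed.

Section Homothets.
Context {R : realType} {d : nat} (C : set 'rV[R]_d).

Lemma homothet_compact lam x : compact C -> compact (homothet C lam x).
Proof.
move=> cC; rewrite /homothet; apply: continuous_compact => //.
apply: continuous_subspaceT => v.
apply: (@cvgD _ _ _ (nbhs v) _ (fun c => lam *: c) (fun=> x)).
  exact: (@scaler_continuous R _ lam).
exact: cvg_cst.
Qed.

Lemma homothet_closed lam x : compact C -> closed (homothet C lam x).
Proof. by move=> cC; apply: compact_closed; [exact: norm_hausdorff|exact: homothet_compact]. Qed.

End Homothets.

(* Translate [C] so that its point of largest first coordinate becomes [p]; then [p]
   lies on the boundary. *)
Lemma point_null (R : realType) (d : nat) (C : set 'rV[R]_d.+1) mu p :
  borel_measure mu -> compact C -> C !=set0 -> non_degenerate mu C -> mu [set p] = 0%E.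
Proof.
move=> bmu cC C0 nd.
have [c cC1 cmax] : exists2 c, c \in C & forall t, t \in C -> t ord0 ord0 <= c ord0 ord0.
  apply: (@EVT_max_rV _ _ (fun v : 'rV[R]_d.+1 => v ord0 ord0)) => //.
  by apply: continuous_subspaceT => v; exact: coord_continuous.
have H : homothet C 1 (p - c) p.
  by exists c; [exact: set_mem|rewrite scale1r addrC subrK].
have clH := homothet_closed (lam := 1) (x := p - c) cC.
have bnd : Defs.boundary (homothet C 1 (p - c)) p.
  split; first exact: subset_closure.
  move=> /nbhs_ballP [e /= e0 he].
  (* An interior [p] could be pushed along the first axis inside the homothet, giving a point of [C]
     with a larger first coordinate than [c]. *)
  have : homothet C 1 (p - c) (p + (e / 2) *: delta_mx ord0 ord0).
    apply: he; rewrite -ball_normE /= opprD addrA subrr add0r normrN.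
    apply: le_lt_trans (_ : e / 2 < e); last by lra.
    rewrite normrZ gtr0_norm ?divr_gt0//.
    apply: ler_piMr; first by rewrite ltW// divr_gt0.
    by apply: norm_rV_le => // i; rewrite mxE; case: (_ && _); rewrite ?normr1 ?normr0.
  move=> [c' /mem_set/cmax + E]; have -> : c' = c + (e / 2) *: delta_mx ord0 ord0.
    rewrite -[LHS](addrK (p - c)) -[c' in LHS]scale1r E.
    by apply/rowP => i; rewrite !mxE; ring.
  rewrite !mxE !eqxx /= mulr1; have := divr_gt0 e0 (ltr0n R 2); lra.
apply/eqP; rewrite eq_le; apply/andP; split; last first.
  by apply: (borel_ge0 bmu); apply: borel_closed; exact: closed_point.
rewrite -(nd 1 (p - c) ltr01); apply: (borel_le bmu) => [||_ ->//].
  by apply: borel_closed; exact: closed_point.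
rewrite /Defs.boundary setDE; apply: borel_closed; apply: closedI; first exact: closed_closure.
by apply: open_closedC; exact: open_interior.
Qed.

Section Radius.
Context {R : realType} {d : nat} (C : set 'rV[R]_d) (mu : set 'rV[R]_d -> \bar R).
Variables (x0 : 'rV[R]_d) (B : 'M[R]_d) (m : nat).
Hypothesis convC : Defs.convex_set C.
Hypothesis compC : compact C.
Hypothesis unitB : B \in unitmx.
Hypothesis ball_in : forall v, `|v *m B| <= 1 -> C (x0 + v).
Hypothesis in_ball : forall v, C (x0 + v) -> `|v *m B| <= m%:R.
Hypothesis bmu : borel_measure mu.
Hypothesis fmu : finite_on_compacts mu.
Hypothesis nd : non_degenerate mu C.
Hypothesis pos : (0 < mu C)%E.
Hypothesis inf : mu setT = +oo%E.
Hypothesis pt0 : forall p, mu [set p] = 0%E.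
Local Notation homothet_at := (homothet_at C x0).

Lemma homothet_at_closed p l : closed (homothet_at p l).
Proof. exact: homothet_closed. Qed.

Lemma homothet_at_borel p l : borel_set (homothet_at p l).
Proof. by apply: borel_closed; exact: homothet_at_closed. Qed.

Lemma homothet_at_finite p l : (mu (homothet_at p l) < +oo)%E.
Proof. by apply: fmu; exact: homothet_compact. Qed.

Lemma homothet_at_muS p l l' : 0 < l -> l <= l' -> (mu (homothet_at p l) <= mu (homothet_at p l'))%E.
Proof.
move=> l0 ll; apply: (borel_le bmu); [exact: homothet_at_borel|exact: homothet_at_borel|].
exact: (homothet_at_le convC unitB ball_in).
Qed.

(** Homothets of radius [1/(n+1)] decrease to the null set [{p}], so they cannot all have measure at
    least [mu C > 0]. *)
Lemma small_homothet_at p : exists2 l, 0 < l & (mu (homothet_at p l) <= mu C)%E.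
Proof.
apply: contrapT => h.
have H n : (mu C <= mu (homothet_at p n.+1%:R^-1))%E.
  apply/ltW; rewrite ltNge; apply/negP => hn; apply: h.
  by exists n.+1%:R^-1 => //; rewrite invr_gt0.
have := @borel_bigcap_ge _ _ _ bmu (fun n => homothet_at p n.+1%:R^-1) _ (fun n => homothet_at_borel _ _) _ (homothet_at_finite _ _) H.
have -> : \bigcap_n homothet_at p n.+1%:R^-1 = [set p].
  apply/seteqP; split => [x hx|_ -> n _]; last by apply: (homothet_at_center ball_in); rewrite invr_gt0.
  have hN n : `|(x - p) *m B| <= m%:R * n.+1%:R^-1.
    by apply: (homothet_at_in_ball in_ball); [rewrite invr_gt0|exact: hx].
  suff /eqP : (x - p) *m B = 0.
    move=> /eqP e; apply/eqP; rewrite -subr_eq0 -[x - p](mulmxK unitB) e mul0mx //.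
  apply/eqP; rewrite -normr_le0 leNgt; apply/negP => N0.
  have := truncn_itv (divr_ge0 (ler0n R m) (ltW N0)); set k := Num.truncn _ => /andP[_].
  rewrite ltr_pdivrMr// => hk; have := hN k; rewrite ler_pdivlMr// leNgt mulrC.
  by rewrite hk.
move=> hh; suff : (mu C <= 0)%E by rewrite leNgt pos.
rewrite -(pt0 p); apply: hh => a b ab; rewrite subsetEset.
by apply: (homothet_at_le convC unitB ball_in); rewrite ?invr_gt0// lef_pV2 ?posrE// ler_nat.
Qed.

(** Homothets of radius [n+1] exhaust a space of infinite measure, while [mu C] is finite by
    compactness. *)
Lemma large_homothet_at p : exists2 l, 0 < l & (mu C < mu (homothet_at p l))%E.
Proof.
apply: contrapT => h.
have H n : (mu (homothet_at p n.+1%:R) <= mu C)%E.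
  by rewrite leNgt; apply/negP => hn; apply: h; exists n.+1%:R.
have ndF : nondecreasing_seq (fun n => homothet_at p n.+1%:R).
  by move=> a b ab; rewrite subsetEset; apply: (homothet_at_le convC unitB ball_in); rewrite ?ler_nat.
have := borel_bigcup_le bmu (fun n => homothet_at_borel p n.+1%:R) ndF H.
have -> : \bigcup_n homothet_at p n.+1%:R = setT.
  apply/seteqP; split => // x _; exists (Num.truncn `|(x - p) *m B|) => //.
  apply: (homothet_at_ball_in ball_in) => //.
  by have /andP[_ /ltW] := truncn_itv (normr_ge0 ((x - p) *m B)).
by rewrite inf leye_eq => /eqP E; have := fmu compC; rewrite E ltxx.
Qed.

(** An interior point stays in the homothet when pushed slightly away from [p], and undoing the push
    shrinks the radius. Thus the interior is covered by a sequence of smaller concentric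
    homothets. *)
Lemma interior_homothet_at p s x : 0 < s -> interior (homothet_at p s) x ->
  exists n : nat, homothet_at p (s / (1 + n.+1%:R^-1)) x.
Proof.
move=> s0 ix.
have cz : (fun n : nat => x + n.+1%:R^-1 *: (x - p)) @ \oo --> x.
  rewrite -[X in _ --> X]addr0; apply: cvgD; first exact: cvg_cst.
  by rewrite -(scale0r (x - p)); apply: cvgZr_tmp; exact: cvg_harmonic.
have [n _ hn] := cz _ ix; exists n; have := hn n (leqnn n) => /= /homothet_atP => /(_ s0) h.
have n0 : 0 < 1 + n.+1%:R^-1 :> R by rewrite addr_gt0// invr_gt0.
apply/homothet_atP; first by rewrite divr_gt0.
rewrite invf_div mulrC -scalerA; move: h; congr (C (_ + _ *: _)).
by rewrite scalerDl scale1r addrAC.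
Qed.

Lemma radius_exists p : exists l, [/\ 0 < l, mu (homothet_at p l) = mu C &
  forall l', 0 < l' -> (mu (homothet_at p l') <= mu C)%E -> l' <= l].
Proof.
pose E := [set l | 0 < l /\ (mu (homothet_at p l) <= mu C)%E].
have [l1 l10 l1C] := small_homothet_at p; have [l2 l20 l2C] := large_homothet_at p.
have supE : has_sup E.
  split; first by exists l1.
  exists l2 => l [l0 lC]; rewrite leNgt; apply/negP => /ltW ll.
  by have := lt_le_trans l2C (le_trans (homothet_at_muS p l20 ll) lC); rewrite ltxx.
have ubE l : E l -> l <= sup E by move=> El; apply: sup_upper_bound.
have s0 : 0 < sup E by apply: (lt_le_trans l10); apply: ubE; split.
exists (sup E); split=> // [|l' l0 lC]; last by apply: ubE; split.
set s := sup E in s0 ubE *.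
apply/eqP; rewrite eq_le; apply/andP; split.
(* Upper bound: the smaller homothets have measure at most [mu C], and their union misses only part
   of the null boundary. *)
- pose F n := homothet_at p (s / (1 + n.+1%:R^-1)).
  have n0 n : 0 < 1 + n.+1%:R^-1 :> R by rewrite addr_gt0// invr_gt0.
  have F0 n : 0 < s / (1 + n.+1%:R^-1) by rewrite divr_gt0.
  have bF n : borel_set (F n) by exact: homothet_at_borel.
  have ndF : nondecreasing_seq F.
    move=> a b ab; rewrite subsetEset; apply: (homothet_at_le convC unitB ball_in) => //.
    by rewrite ler_pM2l// lef_pV2 ?posrE// lerD2l lef_pV2 ?posrE// ler_nat.
  have FC n : (mu (F n) <= mu C)%E.
    have [l [l0 lC] sl] : exists2 l, E l & s / (1 + n.+1%:R^-1) < l.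
      have e0 : 0 < s - s / (1 + n.+1%:R^-1).
        by rewrite subr_gt0 ltr_pdivrMr// ltr_pMr// ltrDl invr_gt0.
      have [l El hl] := sup_adherent e0 supE; exists l => //.
      by move: hl; rewrite opprB addrC subrK.
    by apply: le_trans (homothet_at_muS _ _ (ltW sl)) lC.
  have bB : borel_set (Defs.boundary (homothet_at p s)).
    rewrite /Defs.boundary setDE; apply: borel_closed; apply: closedI; first exact: closed_closure.
    by apply: open_closedC; exact: open_interior.
  rewrite -[leRHS]adde0 -(nd (p - s *: x0) s0).
  apply: le_trans (_ : mu (\bigcup_n F n) + mu (Defs.boundary (homothet_at p s)) <= _)%E; last first.
    by rewrite leeD// (borel_bigcup_le bmu).
  apply: (borel_leU bmu) => //; [exact: homothet_at_borel|exact: borel_bigcup|].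
  move=> x hx; have [ix|nix] := pselect (interior (homothet_at p s) x); last first.
    by right; split => //; exact: subset_closure.
  by left; have [n hn] := interior_homothet_at s0 ix; exists n.
(* Lower bound: radii above the supremum give measure more than [mu C], and these homothets decrease
   to the one of radius [s] because [C] is closed. *)
- pose F n := homothet_at p (s + n.+1%:R^-1).
  have F0 n : s < s + n.+1%:R^-1 by rewrite ltrDl invr_gt0.
  have := @borel_bigcap_ge _ _ _ bmu F (mu C) (fun n => homothet_at_borel _ _) _ (homothet_at_finite _ _) _.
  have -> : \bigcap_n F n = homothet_at p s.
    apply/seteqP; split=> [x hx|x hx n _]; last first.
      by move: hx; apply: (homothet_at_le convC unitB ball_in) => //; exact: ltW.
    apply/homothet_atP => //.
    apply: (@closed_cvg _ _ \oo _ (fun n : nat => x0 + (s + n.+1%:R^-1)^-1 *: (x - p)) C).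
    + exact: (compact_closed (@norm_hausdorff _ _) compC).
    + apply: nearW => n; have := hx n I; rewrite /F => /homothet_atP; apply.
      exact: lt_trans s0 (F0 n).
    + have c0 : (fun n : nat => s + n.+1%:R^-1) @ \oo --> s.
        by rewrite -[X in _ --> X]addr0; apply: cvgD; [exact: cvg_cst|exact: cvg_harmonic].
      have c1 : (fun n : nat => (s + n.+1%:R^-1)^-1) @ \oo --> s^-1.
        by apply: cvgV => //; rewrite gt_eqF.
      have c2 : (fun n : nat => (s + n.+1%:R^-1)^-1 *: (x - p)) @ \oo --> s^-1 *: (x - p).
        exact: cvgZr_tmp.
      apply: (@cvgD _ _ _ _ _ (fun=> x0)); [exact: cvg_cst|exact: c2].
  apply=> [a b ab|n].
    rewrite subsetEset; apply: (homothet_at_le convC unitB ball_in); first exact: lt_trans s0 (F0 b).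
    by rewrite lerD2l lef_pV2 ?posrE// ler_nat.
  apply/ltW; rewrite ltNge; apply/negP => h.
  have := ubE (s + n.+1%:R^-1); rewrite leNgt F0 => /(_ _)/negP.
  by case; split => //; exact: lt_trans s0 (F0 n).
Qed.

(** The homothet at [q] of radius [lam p - |(p - q) *m B|] lies inside the one chosen at [p], so its
    measure is at most [mu C] and maximality at [q] applies. *)
Lemma radius_lipschitz (lam : 'rV[R]_d -> R) :
  (forall p, [/\ 0 < lam p, mu (homothet_at p (lam p)) = mu C &
     forall l', 0 < l' -> (mu (homothet_at p l') <= mu C)%E -> l' <= lam p]) ->
  forall p q, lam p - lam q <= `|(p - q) *m B|.
Proof.
move=> hl p q; have [p0 pC _] := hl p; have [q0 _ qmax] := hl q.
rewrite lerBlDr addrC -lerBlDr; have [h|h] := ltP 0 (lam p - `|(p - q) *m B|); last first.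
  by apply: le_trans h (ltW q0).
apply: qmax => //; rewrite -pC; apply: (borel_le bmu); [exact: homothet_at_borel|exact: homothet_at_borel|].
apply: (homothet_at_mono convC unitB ball_in) => //.
  by rewrite lerBlDr lerDl.
by rewrite subKr -opprB mulNmx normrN.
Qed.

(** A positive continuous function has a positive minimum on a compact ball; this bound makes the
    greedy selection finite. *)
Lemma radius_lower_bound (lam : 'rV[R]_d -> R) (r : R) : (forall p, 0 < lam p) ->
  (forall p q, lam p - lam q <= `|(p - q) *m B|) ->
  exists2 a, 0 < a & forall p, `|p| <= r -> a <= lam p.
Proof.
move=> lam0 lip; have [K K0 hK] := mulmx_norm_le B.
have [r0|r0] := ltP r 0.
  by exists 1 => // p hp; have := le_lt_trans (le_trans (normr_ge0 p) hp) r0; rewrite ltxx.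
pose S := [set v : 'rV[R]_d | `|v| <= r].
have cS : compact S := @compact_norm_le _ _ r.
have cont : {within S, continuous lam}.
  apply: continuous_subspaceT => p; apply/(@cvgrPdist_lt _ _ _ (nbhs p) _ lam (lam p)) => e e0.
  apply/nbhs_ballP; exists (e / K); first by rewrite /= divr_gt0.
  move=> q; rewrite -ball_normE /= ltr_pdivlMr// mulrC => hq.
  have h x y : lam x - lam y <= K * `|p - q| -> lam x - lam y < e.
    by move=> xy; exact: le_lt_trans hq.
  rewrite ltr_norml; apply/andP; split; last by apply: h; apply: le_trans (lip _ _) (hK _).
  rewrite ltrNl opprB; apply: h; apply: le_trans (lip _ _) _.
  by rewrite -opprB mulNmx normrN; exact: hK.
have [|c _ cmin] := EVT_min_rV _ cS cont; first by exists 0; rewrite /S /= normr0.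
by exists (lam c) => // p hp; apply: cmin; exact: mem_set.
Qed.

(** On a bounded set the Lipschitz estimate from the origin bounds the radii above, and the positive
    lower bound limits the length of separated sequences, so [greedy] applies. *)
Lemma radius_cover (lam : 'rV[R]_d -> R) (r : R) (T : set 'rV[R]_d) :
  (forall p, 0 < lam p) ->
  (forall p q, lam p - lam q <= `|(p - q) *m B|) ->
  (forall p, T p -> `|p| <= r) ->
  exists s, [/\ forall p, p \in s -> T p, pairwise (selected C x0 lam) s &
     forall x, T x -> exists2 p, p \in s & homothet_at p (lam p) x].
Proof.
move=> lam0 lip Tr; have [K K0 hK] := mulmx_norm_le B.
have [a a0 ha] := radius_lower_bound r lam0 lip.
pose r1 := 1 + `|r|; have r10 : 0 < r1 by rewrite ltr_wpDr.
have Tr1 p : T p -> `|p *m B| <= K * r1.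
  move=> /Tr pr; apply: le_trans (hK p) _; rewrite ler_pM2l//.
  by apply: le_trans pr _; apply: le_trans (ler_norm _) _; rewrite lerDr.
have [n hn] := separated_size B a0 (mulr_gt0 K0 r10).
apply: (@greedy _ _ _ _ _ ball_in _ a (lam 0 + K * r1) T n a0) => [p Tp|s sT ps].
  rewrite ha ?Tr//=; have := lip p 0; rewrite subr0 lerBlDr addrC => h.
  by apply: le_trans h _; rewrite lerD2l Tr1.
by apply: hn ps => p /sT /Tr1.
Qed.

End Radius.

(** * Exhaustion by Euclidean balls *)

Section EuclideanBalls.
Context {R : realType} {d : nat}.
Implicit Types (v : 'rV[R]_d) (r : R).

Lemma eball_norm r v : eball r v -> `|v| <= `|r|.
Proof.
move=> h; apply: norm_rV_le => // i; rewrite -ler_sqr ?nnegrE// !real_normK ?num_real//.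
apply: le_trans (ltW h); rewrite (bigD1 i)//= lerDl sumr_ge0// => j _; exact: sqr_ge0.
Qed.

Lemma eball_open r : open (eball r : set 'rV[R]_d).
Proof.
rewrite (_ : eball r = (fun v => \sum_(i < d) (v ord0 i) ^+ 2) @^-1` [set x | x < r ^+ 2]) //.
apply: open_comp => [v _|]; last exact: open_lt.
move: v; apply: (@continuous_big R 'I_d _ 0 predT _ 'rV[R]_d (index_enum _) (fun i (u : 'rV[R]_d) => (u ord0 i) ^+ 2)) => [|i _ v].
  exact: (@add_continuous R).
apply: (@cvgM _ _ (nbhs v) _ (fun u : 'rV[R]_d => u ord0 i) (fun u : 'rV[R]_d => u ord0 i));
  exact: coord_continuous.
Qed.

Lemma eball_le r r' : 0 <= r -> r <= r' -> (eball r : set 'rV[R]_d) `<=` eball r'.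
Proof.
move=> r0 rr v h; apply: lt_le_trans h _.
by rewrite ler_sqr ?nnegrE// (le_trans r0).
Qed.

Lemma eball_exhaust v : exists n : nat, eball n%:R v.
Proof.
set s := \sum_(i < d) (v ord0 i) ^+ 2.
have s0 : 0 <= s by apply: sumr_ge0 => i _; exact: sqr_ge0.
exists (Num.truncn s).+1; rewrite /eball /= -/s; have /andP[_ h] := truncn_itv s0.
by apply: lt_le_trans h _; rewrite expr2 ler_peMl// ler1n.
Qed.

Lemma eball0 v : ~ eball 0 v.
Proof.
rewrite /eball /= expr0n /= => h; suff : 0 < 0 :> R by rewrite ltxx.
by apply: le_lt_trans h; apply: sumr_ge0 => i _; exact: sqr_ge0.
Qed.

Variable mu : set 'rV[R]_d -> \bar R.
Hypotheses (bmu : borel_measure mu) (fmu : finite_on_compacts mu).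

Lemma borel_eball r : borel_set (eball r : set 'rV[R]_d).
Proof. by apply: borel_open; exact: eball_open. Qed.

Lemma eball_finite r : (mu (eball r) < +oo)%E.
Proof.
have cB := @compact_norm_le _ d `|r|; apply: le_lt_trans (fmu cB).
apply: (borel_le bmu); [exact: borel_eball| |exact: eball_norm].
by apply: borel_closed; apply: compact_closed cB; exact: norm_hausdorff.
Qed.

Lemma eball_large (c r0 : R) : mu setT = +oo%E ->
  exists r, r0 <= r /\ (c%:E <= mu (eball r))%E.
Proof.
move=> inf; apply: contrapT => h.
(* Shifting the indices by [k] keeps all radii of the exhausting balls above [r0]. *)
pose k := (Num.truncn `|r0|).+1.
have k0 : r0 <= k%:R.
  apply: le_trans (ler_norm _) _.
  by have /andP[_ /ltW] := truncn_itv (normr_ge0 r0).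
have H n : (mu (eball (n + k)%:R) <= c%:E)%E.
  apply/ltW; rewrite ltNge; apply/negP => hn; apply: h.
  by exists (n + k)%:R; split => //; apply: le_trans k0 _; rewrite ler_nat leq_addl.
have ndF : nondecreasing_seq (fun n => eball (n + k)%:R : set 'rV[R]_d).
  by move=> a b ab; rewrite subsetEset; apply: eball_le => //; rewrite ler_nat leq_add2r.
have := borel_bigcup_le bmu (fun n => borel_eball (n + k)%:R) ndF H.
have -> : \bigcup_n eball (n + k)%:R = [set: 'rV[R]_d].
  apply/seteqP; split => // v _; have [n hn] := eball_exhaust v; exists n => //.
  by apply: eball_le hn => //; rewrite ler_nat leq_addr.
by rewrite inf leye_eq.
Qed.

End EuclideanBalls.

(** * The covering by annuli and its inner density *)

Lemma esum_le_seq (R : realType) (T : choiceType) (I : eqType) (f : T -> \bar R) (H : I -> T)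
    (s : seq I) (P : set T) :
  (forall i, 0 <= f (H i))%E -> (forall X, P X -> exists2 i, i \in s & X = H i) ->
  (\esum_(X in P) f X <= \sum_(i <- s) f (H i))%E.
Proof.
move=> f0; elim: s P => [|i s ih] P hP.
  rewrite big_nil (_ : P = set0) ?esum_set0//.
  by apply/seteqP; split => // X /hP[].
have fP X : P X -> (0 <= f X)%E by move=> /hP[j _ ->].
(* A sum over a set counts [H i] at most once, however often it is listed; the other members are
   listed in the tail. *)
rewrite big_cons (esumID [set H i])//; apply: leeD.
  rewrite -(@esum_set1 _ _ (H i) f)//.
  have [h|h] := pselect (P (H i)).
    by rewrite (_ : P `&` _ = [set H i])//; apply/seteqP; split=> [X []//|_ ->].
  rewrite (_ : P `&` _ = set0) ?esum_set0 ?esum_set1//.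
  by apply/seteqP; split=> [X [+ E]|//]; rewrite E.
apply: ih => X [/hP[j + E] nE]; rewrite inE => /orP[/eqP ji|js]; last by exists j.
by case: nE; rewrite /= E ji.
Qed.

Section Assembly.
Context {R : realType} {d : nat} (C : set 'rV[R]_d) (mu : set 'rV[R]_d -> \bar R).
Variables (H : 'rV[R]_d -> set 'rV[R]_d) (N : nat).
Hypotheses (bmu : borel_measure mu) (fmu : finite_on_compacts mu).
Hypothesis pos : (0 < mu C)%E.
Hypothesis finC : (mu C < +oo)%E.
Hypothesis inf : mu setT = +oo%E.
Hypothesis H_homothet : forall p, is_homothet C (H p).
Hypothesis H_mu : forall p, mu (H p) = mu C.
Hypothesis H_center : forall p, H p p.
Hypothesis H_borel : forall p, borel_set (H p).
Hypothesis H_cover : forall (r : R) (T : set 'rV[R]_d), (forall p, T p -> `|p| <= r) ->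
  exists s, [/\ forall p, p \in s -> T p,
    forall x, (size [seq p <- s | `[< H p x >]] <= N)%N &
    forall x, T x -> exists2 p, p \in s & H p x].

Let M := fine (mu C).
Let MC : mu C = M%:E.
Proof. by rewrite fineK// ge0_fin_numE// ltW. Qed.

(** Here [n] stands for the number of centres chosen earlier, whose homothets have total measure
    [n * M]. The extra 1 makes the new ball's measure positive, and [r + 1] makes the radii tend to
    infinity. *)
Let annulus_cover (r : R) (n : nat) : exists z : R * seq 'rV[R]_d,
  [/\ r + 1 <= z.1, ((n%:R * M + 1)%:E <= mu (eball z.1))%E,
    forall p, p \in z.2 -> ~ eball r p,
    forall x, (size [seq p <- z.2 | `[< H p x >]] <= N)%N &
    forall x, eball z.1 x -> ~ eball r x -> exists2 p, p \in z.2 & H p x].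
Proof.
have [r' [rr' hr']] := eball_large bmu (n%:R * M + 1) (r + 1) inf.
have [p /= [/eball_norm]//|s [h1 h2 h3]] := @H_cover `|r'| (eball r' `\` eball r).
by exists (r', s); split => //= [p /h1[]//|x *]; apply: h3.
Qed.

Let next r n := projT1 (cid (annulus_cover r n)).

(* A state consists of a radius, the centres selected for its annulus, and the
   centres selected up to and including that stage. *)
Let step (z : R * seq 'rV[R]_d * seq 'rV[R]_d) :=
  (next z.1.1 (size z.2), z.2 ++ (next z.1.1 (size z.2)).2).
Let st k := iter k step (0, [::], [::]).
Let rad k := (st k).1.1.
Let pts k := (st k).1.2.
Let acc k := (st k).2.

Let st_spec k :
  [/\ rad k + 1 <= rad k.+1, (((size (acc k))%:R * M + 1)%:E <= mu (eball (rad k.+1)))%E,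
    forall p, p \in pts k.+1 -> ~ eball (rad k) p,
    forall x, (size [seq p <- pts k.+1 | `[< H p x >]] <= N)%N &
    forall x, eball (rad k.+1) x -> ~ eball (rad k) x -> exists2 p, p \in pts k.+1 & H p x].
Proof. exact: (projT2 (cid (annulus_cover (rad k) (size (acc k))))). Qed.

Let accS k : acc k.+1 = acc k ++ pts k.+1.
Proof. by []. Qed.

Let rad_ge k : k%:R <= rad k.
Proof.
elim: k => [|k ih]; first exact: lexx.
by have [h _ _ _ _] := st_spec k; apply: le_trans h; rewrite -natr1 lerD2r.
Qed.

Let rad_ge0 k : 0 <= rad k.
Proof. exact: le_trans (rad_ge k). Qed.

Let rad_mono j k : (j <= k)%N -> rad j <= rad k.
Proof.
move=> jk; rewrite -(subnK jk); elim: (k - j)%N => // i ih; rewrite addSn.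
have [h _ _ _ _] := st_spec (i + j); apply: le_trans ih _; apply: le_trans h.
by rewrite lerDl.
Qed.

Let pts_acc j k p : (j <= k)%N -> p \in pts j -> p \in acc k.
Proof.
elim: k => [|k ih]; first by rewrite leqn0 => /eqP ->.
rewrite leq_eqVlt accS mem_cat => /orP[/eqP ->|jk] hp; first by rewrite hp orbT.
by rewrite ih.
Qed.

Let family : set (set 'rV[R]_d) := [set X | exists k p, p \in pts k /\ X = H p].

Let family_covering : hcovering mu C family.
Proof.
split=> [X [k [p [_ ->]]]//|]; apply/seteqP; split => // x _.
have [n hn] := eball_exhaust x.
have : eball (rad n) x by apply: eball_le hn.
elim: (n) => [/eball0//|k ih hk]; have [h|h] := pselect (eball (rad k) x); first exact: ih.
have [_ _ _ _ hc] := st_spec k; have [p pk hp] := hc x hk h.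
by exists (H p) => //; exists k.+1, p.
Qed.

Let family_density k : (d_inn mu family (eball (rad k.+1)) <= N.+1%:R%:E)%E.
Proof.
have [_ hmu hout hN _] := st_spec k; set D := eball _ in hmu *.
have finD := eball_finite bmu fmu (rad k.+1); rewrite -/D in finD.
have bD : borel_set D by exact: borel_eball.
have DE : mu D = (fine (mu D))%:E by rewrite fineK// ge0_fin_numE//; exact: borel_ge0.
rewrite /d_inn; set m := fine (mu D) in DE *.
have M0 : 0 <= M by rewrite -lee_fin -MC ltW.
have m0 : 0 < m.
  by move: hmu; rewrite DE lee_fin; apply: lt_le_trans; rewrite ltr_wpDl// mulr_ge0.
rewrite lee_pdivrMr//.
pose L := [seq p <- pts k.+1 | `[< H p `<=` D >]] ++ acc k.
apply: le_trans (_ : \sum_(p <- L) mu (H p) <= _)%E.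
  apply: esum_le_seq => [p|X [[j [p [pj ->]]] XD]]; first by rewrite H_mu ltW.
  exists p => //; rewrite mem_cat mem_filter.
  (* Earlier stages are recorded in [acc k]. A later stage is impossible: its homothet contains its
     centre, which lies outside the ball of radius [rad k.+1]. *)
  have [jk|jk|jk] := ltngtP j k.+1; last by rewrite -jk pj asboolT.
    by rewrite (pts_acc (j := j)) ?orbT.
  case: j jk pj => // j jk pj; have [_ _ hj _ _] := st_spec j.
  case: (hj _ pj); apply: eball_le (XD _ (H_center p)) => //; exact: rad_mono.
(* The current stage contributes at most [N * mu D] by bounded overlap, and all earlier stages
   together at most one further [mu D] by the choice of radius. *)
rewrite big_cat /= big_filter -natr1 EFinD muleDl// mul1e; apply: leeD.
  by rewrite -DE; apply: borel_overlap.
apply: le_trans (_ : ((size (acc k))%:R * M)%:E <= _)%E; last first.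
  by move: hmu; rewrite DE; apply: le_trans; rewrite lee_fin lerDl.
elim: (acc k) => [|p s ih]; first by rewrite big_nil mul0r.
by rewrite big_cons /= -natr1 mulrDl mul1r addrC EFinD H_mu MC leeD.
Qed.

Lemma Theta_H_le : (Theta_H mu C <= N.+1%:R%:E)%E.
Proof.
apply: le_trans (_ : d_low mu family <= _)%E.
  by apply: ereal_inf_lbound; exists family.
apply: ge_ereal_sup => _ [r0 _ <-].
(* The lower density is a supremum over [r0] of infima over [r >= r0], so one stage radius beyond
   each [r0] suffices. *)
pose k := Num.truncn `|r0|.
apply: le_trans (family_density k); apply: ereal_inf_lbound.
exists (rad k.+1) => //=; apply: le_trans (rad_ge _); apply: le_trans (ler_norm _) _.
by have /andP[_ /ltW] := truncn_itv (normr_ge0 r0).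
Qed.

End Assembly.

Theorem mainTheorem4 (R : realType) :
  exists F : nat -> R,
  forall (d : nat) (C : set 'rV[R]_d) (mu : set 'rV[R]_d -> \bar R),
    convex_body C ->
    borel_measure mu -> finite_on_compacts mu ->
    non_degenerate mu C ->
    (0 < mu C)%E -> mu [set: 'rV[R]_d] = +oo%E ->
    (Theta_H mu C <= (F d)%:E)%E.
Proof.
exists (fun d => (@multiplicity d (3 * d.+1 ^ 2)).+1%:R).
(* In dimension 0 the space is a single point, hence compact, and cannot have infinite measure. *)
case=> [|d] C mu [convC [cC iC]] bmu fmu nd pos inf.
  have := fmu _ (@compact_norm_le R 0%N 0); rewrite (_ : [set _ | _] = setT) ?inf ?ltxx//.
  by apply/seteqP; split => // v _; rewrite /= thinmx0 normr0.
have C0 : C !=set0 by have [c /interior_subset Cc] := iC; exists c.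
have [x0 [B [uB [bi ib]]]] := convex_body_position convC (compact_bounded cC) iC.
have pt0 p := point_null p bmu cC C0 nd.
have [lam hl] := choice (radius_exists convC cC uB bi ib bmu fmu nd pos inf pt0).
have lam0 p : 0 < lam p by have [] := hl p.
have lip := radius_lipschitz convC cC uB bi bmu hl.
apply: (@Theta_H_le _ _ _ _ (fun p => homothet_at C x0 p (lam p))) => //.
- exact: fmu.
- by move=> p; exact: homothet_at_is_homothet.
- by move=> p; have [] := hl p.
- by move=> p; exact: (homothet_at_center bi).
- by move=> p; exact: homothet_at_borel.
- move=> r T Tr; have [s [h1 h2 h3]] := radius_cover bi lam0 lip Tr.
  by exists s; split=> // x; apply: (multiplicity_le convC uB bi ib).
Qed.
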